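(* Let $p\ge2$ be an integer. Consider the primal problem $\min_{x\in Q}\{f(x):Ax=b\}$ and its dual function $\varphi(\lambda)=\langle\lambda,b\rangle+\max_{x\in Q}\left(-f(x)-\langle A^{\top}\lambda,x\rangle\right)$, $\lambda\in\mathbb{R}^m$, as set up in the context. Assume $\varphi$ is convex and $p$ times differentiable on $\mathbb{R}^m$ with $M_p$-Lipschitz $p$-th derivative, that $\varphi$ has a minimizer $\lambda^*$, and that there is $R>0$ with $\|\lambda^*\|_2\le R<\infty$. Let $M>M_p$, and let the Primal-Dual Accelerated Tensor Method (defined in the context) be run for $k\ge1$ steps from $\lambda_0=v_0=0$, with $\hat x_k=\frac1{A_k}\sum_{i=0}^{k-1}a_i\,x(\lambda_{i+1})$. Then $$\|A\hat x_k-b\|_2\le\frac{C_1R^{p}}{k^{p+1}},\qquad |\varphi(\lambda_k)+f(\hat x_k)|\le\frac{C_1R^{p+1}}{k^{p+1}},$$ where $$C_1=\frac{4^pM^p}{(p-1)!}\sqrt{\frac{(p+1)^{3p+3}}{(M^2-M_p^2)^{p-1}(p-1)^{p+1}}}.$$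
   Context: Setup. $E$ is a finite-dimensional real vector space, $Q\subseteq E$ is closed and convex, $f$ is convex on $Q$, $A:E\to\mathbb{R}^m$ is linear with adjoint $A^\top$, $b\in\mathbb{R}^m$. For every $\lambda$ the maximum defining $\varphi(\lambda)$ is attained; $x(\lambda)$ denotes a maximizer, $x(\lambda)\in\arg\max_{x\in Q}(-f(x)-\langle A^\top\lambda,x\rangle)$, and $\nabla\varphi(\lambda)=b-Ax(\lambda)$ (Demyanov–Danskin). The dual problem is $\min_{\lambda\in\mathbb{R}^m}\varphi(\lambda)$. Conventions. $\|\cdot\|_2$ is the Euclidean norm; for a symmetric $p$-linear form, $\|\nabla^p\varphi(\lambda)\|_2=\max\{\nabla^p\varphi(\lambda)[h_1,\dots,h_p]:\|h_i\|_2\le1\}$. ''$M_p$-Lipschitz $p$-th derivative'' means $\|\nabla^p\varphi(\lambda)-\nabla^p\varphi(\lambda')\|_2\le M_p\|\lambda-\lambda'\|_2$ for all $\lambda,\lambda'$. Tensor step. $T^\varphi_{p,M}(\lambda)\in\operatorname{Arg\,min}_{y\in\mathbb{R}^m}\left\{\sum_{i=0}^p\frac1{i!}\nabla^i\varphi(\lambda)[y-\lambda]^i+\frac{M}{(p+1)!}\|y-\lambda\|_2^{p+1}\right\}$ (a global minimizer), where $\nabla^i\varphi(\lambda)[h]^i=\nabla^i\varphi(\lambda)[h,\dots,h]$. Primal-Dual Accelerated Tensor Method (with parameter $M>M_p$). Let $C=\frac p2\sqrt{\frac{p+1}{p-1}(M^2-M_p^2)}$, $\lambda_0=0$, $\psi_0(\lambda)=\frac{C}{(p+1)!}\|\lambda-\lambda_0\|_2^{p+1}$,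 and for $k\ge0$ $$A_k=\left[\frac{(p-1)(M^2-M_p^2)}{4(p+1)M^2}\right]^{p/2}\left(\frac{k}{p+1}\right)^{p+1},\qquad a_k=A_{k+1}-A_k.$$ For $k=0,1,2,\dots$: $v_k=\arg\min_\lambda\psi_k(\lambda)$; $y_k=\frac{A_k}{A_{k+1}}\lambda_k+\frac{a_k}{A_{k+1}}v_k$; $\lambda_{k+1}=T^\varphi_{p,M}(y_k)$; $\psi_{k+1}(\lambda)=\psi_k(\lambda)+a_k\left[\varphi(\lambda_{k+1})+\langle\nabla\varphi(\lambda_{k+1}),\lambda-\lambda_{k+1}\rangle\right]$; $\hat x_{k+1}=\frac1{A_{k+1}}\sum_{i=0}^{k}a_i\,x(\lambda_{i+1})$. *)

(* Defs.v *)
From HB Require Import structures.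
From mathcomp Require Export all_boot all_order all_algebra.
From mathcomp Require Export all_classical all_reals all_analysis.
Export numFieldNormedType.Exports.

Set Implicit Arguments.
Unset Strict Implicit.
Unset Printing Implicit Defensive.

Import Order.TTheory GRing.Theory Num.Theory.
Local Open Scope classical_set_scope.
Local Open Scope ring_scope.

Section Calculus.
Variables (R : realType) (m : nat).
Local Notation V := 'rV[R]_m.
Implicit Types (u v x y h : V) (f g : V -> R).

Definition dot u v : R := \sum_i u 0 i * v 0 i.

(* The norm `|v| carried by 'rV[R]_m is the sup norm, not this one. *)
Definition norm2 v : R := Num.sqrt (dot v v).

Definition is_argmin g x : Prop := forall y, g x <= g y.

(* nabla f [:: h1; ..; hp] x is the value of the p-linear form
   nabla^p f (x) [h1, .., hp]: differentiate y |-> nabla^(p-1) f (y) [h2, .., hp]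
   at x and apply the differential to h1. *)
Fixpoint nabla f (hs : seq V) : V -> R :=
  if hs is h :: hs' then fun x => 'd (nabla f hs') x h else f.

(* Frechet differentiability, at every point, of the derivatives of order
   0, .., p-1; a map into the finite-dimensional space of i-linear forms is
   differentiable iff all its evaluations at i-tuples of vectors are. *)
Definition p_differentiable p f : Prop :=
  forall hs : seq V, (size hs < p)%N -> forall x, differentiable (nabla f hs) x.

Definition grad f x : V := \row_i 'd f x (delta_mx 0 i).

(* max {T [h1, .., hp] : ||hi||_2 <= 1}; the sup is attained when T is
   multilinear, by compactness. *)
Definition form_norm p (T : p.-tuple V -> R) : R :=
  sup [set T hs | hs in [set hs : p.-tuple V | forall i, norm2 (tnth hs i) <= 1]].

Definition lipschitz_nabla p (Mp : R) f : Prop :=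
  forall x y,
    form_norm (fun hs : p.-tuple V => nabla f hs x - nabla f hs y)
    <= Mp * norm2 (x - y).

Definition tensor_model p (M : R) f x : V -> R := fun y =>
  \sum_(i < p.+1) (i`!%:R)^-1 * nabla f (nseq i (y - x)) x
  + M / (p.+1)`!%:R * norm2 (y - x) ^+ p.+1.

End Calculus.

Section Duality.
Variables (R : realType) (E : vectType R) (m : nat).
Local Notation V := 'rV[R]_m.

Definition is_argmax_on (D : set E) (g : E -> R) (x : E) : Prop :=
  D x /\ forall z, D z -> g z <= g x.

(* The topology of E is the one of its coordinate space. *)
Definition vclosed (D : set E) : Prop := closed (VectorInternalTheory.v2r @` D).

(* A^T l, as a linear form on E. *)
Definition adjoint (A : {linear E -> V}) (l : V) : E -> R := fun x => dot l (A x).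

Definition lagrangian (f : E -> R) (A : {linear E -> V}) (l : V) : E -> R :=
  fun x => - f x - adjoint A l x.

Definition dual (Q : set E) (f : E -> R) (A : {linear E -> V}) (b : V) : V -> R :=
  fun l => dot l b + sup [set lagrangian f A l x | x in Q].

End Duality.

Section Method.
Variables (R : realType) (m p : nat) (M Mp : R).
Local Notation V := 'rV[R]_m.

Definition const_C : R :=
  p%:R / 2 * Num.sqrt ((p%:R + 1) / (p%:R - 1) * (M ^+ 2 - Mp ^+ 2)).

Definition seq_A (k : nat) : R :=
  (((p%:R - 1) * (M ^+ 2 - Mp ^+ 2)) / (4 * (p%:R + 1) * M ^+ 2)) `^ (p%:R / 2)
  * (k%:R / (p%:R + 1)) ^+ p.+1.

Definition seq_a (k : nat) : R := seq_A k.+1 - seq_A k.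

Fixpoint psi (phi : V -> R) (l : nat -> V) (k : nat) : V -> R :=
  if k is i.+1 then fun z =>
    psi phi l i z
    + seq_a i * (phi (l i.+1) + dot (grad phi (l i.+1)) (z - l i.+1))
  else fun z => const_C / (p.+1)`!%:R * norm2 (z - l 0%N) ^+ p.+1.

(* The sequences l, v, y are produced by the first k steps of the method. *)
Record method_run (phi : V -> R) (k : nat) (l v y : nat -> V) : Prop := {
  run_l0 : l 0%N = 0;
  run_v0 : v 0%N = 0;
  run_v : forall i, (i < k)%N -> is_argmin (psi phi l i) (v i);
  run_y : forall i, (i < k)%N ->
    y i = (seq_A i / seq_A i.+1) *: l i + (seq_a i / seq_A i.+1) *: v i;
  run_l : forall i, (i < k)%N -> is_argmin (tensor_model p M phi (y i)) (l i.+1)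
}.

Definition xhat (E : vectType R) (xsel : V -> E) (l : nat -> V) (k : nat) : E :=
  (seq_A k)^-1 *: \sum_(i < k) seq_a i *: xsel (l i.+1).

Definition const_C1 : R :=
  4 ^+ p * M ^+ p / (p.-1)`!%:R
  * Num.sqrt ((p%:R + 1) ^+ (3 * p + 3)
              / ((M ^+ 2 - Mp ^+ 2) ^+ p.-1 * (p%:R - 1) ^+ p.+1)).

End Method.

(* Main.v *)
Require Import Defs.
From mathcomp Require Import ring lra.

Set Implicit Arguments.
Unset Strict Implicit.
Unset Printing Implicit Defensive.

Import Order.TTheory GRing.Theory Num.Theory.
Local Open Scope classical_set_scope.
Local Open Scope ring_scope.

(** Write g for the gradient of the dual function phi at the end point T of a
    tensor step from y, and r for the length of the step.  T is a critical
    point of the regularized Taylor model, and the gradient of the Taylor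
    polynomial at T is within Mp r^p / p! of g; hence
    g + (M / p!) r^(p-1) (T - y) has norm at most (Mp / p!) r^p
    (tensor_step_residual).  Since M > Mp, squaring this bounds the progress
    <g, y - T> from below in terms of |g|^2 and r^(2p) (residual_descent).

    The functions psi_k are affine perturbations of a multiple of the power
    p+1 of the Euclidean norm.  By a Clarkson inequality (norm2_midpoint) they
    are uniformly convex, so psi_k grows at least like |z - v_k|^(p+1) away
    from its minimizer (psi_growth).  Passing from psi_k to psi_(k+1) adds the
    term a_k <g, z - v_k>, which could lower the minimum; as long as A_k does
    not increase faster than a multiple of k^(p+1), this loss is covered by the
    growth of psi_k together with the progress of the tensor step
    (step_balance).  By induction A_k phi(l_k) lies below psi_k everywhere
    (estimating_sequence).

    By duality the gradient of phi at mu is b - A (xsel mu) (grad_dual), so by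
    Jensen's inequality the affine part of psi_k is at most
    A_k (<z, w> - f(xhat_k)) with w = b - A xhat_k.  Therefore
    phi(l_k) + f(xhat_k) <= <z, w> + c |z|^(p+1) / A_k for every z, where c is
    the factor of the norm power in psi_0.
    A vector z of length 2 rad opposite to w bounds the left-hand side by
    eps - 2 rad |w|, where eps = c (2 rad)^(p+1) / A_k, whereas weak duality at
    the minimizer lstar bounds it from below by - rad |w|.  So rad |w| <= eps,
    and the duality gap has absolute value at most eps; rate_le compares eps
    with the announced rate.

    The derivatives of order p enter as iterated directional derivatives.
    That they form symmetric multilinear forms, which the derivative of the
    Taylor polynomial requires, is derived from the equality of mixed second
    derivatives (second_derivative_sym, nabla_move). *)

(** * A weighted power mean inequality and Euclidean geometry *)

(** The function t |-> t^((n+2)/2) lies above its tangent; taking t = a^2, with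
    contact point b^2, gives this inequality free of fractional powers. *)
Lemma tangent_power (R : realFieldType) (n : nat) (a b : R) :
  0 <= a -> 0 <= b ->
  n.+2%:R * b ^+ n * a ^+ 2 <= 2 * a ^+ n.+2 + n%:R * b ^+ n.+2.
Proof.
move=> a_ge0 b_ge0; elim: n => [|n IHn]; first by rewrite mul0r addr0 expr0 mulr1.
have sq_ge0 : 0 <= b ^+ n * (a - b) ^+ 2 * (n.+2%:R * a + n.+1%:R * b).
  by apply: mulr_ge0; [rewrite mulr_ge0 ?sqr_ge0// exprn_ge0|
    rewrite addr_ge0// mulr_ge0].
have /(ler_wpM2l a_ge0) := IHn.
rewrite -subr_ge0 => step_ge0; rewrite -subr_ge0.
(* The inequality for n.+1 is a times the one for n plus a nonnegative term with
   a double zero at a = b. *)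
have -> : 2 * a ^+ n.+3 + n.+1%:R * b ^+ n.+3 - n.+3%:R * b ^+ n.+1 * a ^+ 2
    = a * (2 * a ^+ n.+2 + n%:R * b ^+ n.+2)
      - a * (n.+2%:R * b ^+ n * a ^+ 2)
      + b ^+ n * (a - b) ^+ 2 * (n.+2%:R * a + n.+1%:R * b).
  by rewrite -!natr1 !exprS; ring.
exact: addr_ge0.
Qed.

Section Euclidean.
Variables (R : realType) (m : nat).
Local Notation V := 'rV[R]_m.
Implicit Types u v w : V.

Lemma dotC u v : dot u v = dot v u.
Proof. by apply: eq_bigr => i _; rewrite mulrC. Qed.

Lemma dotDl u v w : dot (u + v) w = dot u w + dot v w.
Proof. by rewrite -big_split; apply: eq_bigr => i _; rewrite mxE mulrDl. Qed.

Lemma dotZl c u v : dot (c *: u) v = c * dot u v.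
Proof. by rewrite mulr_sumr; apply: eq_bigr => i _; rewrite mxE mulrA. Qed.

Lemma dotNl u v : dot (- u) v = - dot u v.
Proof. by rewrite -scaleN1r dotZl mulN1r. Qed.

Lemma dotDr u v w : dot u (v + w) = dot u v + dot u w.
Proof. by rewrite dotC dotDl !(dotC u). Qed.

Lemma dotZr c u v : dot u (c *: v) = c * dot u v.
Proof. by rewrite dotC dotZl (dotC u). Qed.

Lemma dotNr u v : dot u (- v) = - dot u v.
Proof. by rewrite dotC dotNl (dotC u). Qed.

Definition dotE := (dotDl, dotDr, dotZl, dotZr, dotNl, dotNr).

Lemma dot0l u : dot 0 u = 0.
Proof. by rewrite -(scale0r 0) dotZl mul0r. Qed.

Lemma dot0r u : dot u 0 = 0.
Proof. by rewrite dotC dot0l. Qed.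

Lemma dotvv_ge0 u : 0 <= dot u u.
Proof. by apply: sumr_ge0 => i _; rewrite -expr2 sqr_ge0. Qed.

Lemma dotvv_eq0 u : (dot u u == 0) = (u == 0).
Proof.
apply/eqP/eqP => [/eqP|->]; last by rewrite dot0l.
rewrite psumr_eq0; last by move=> i _; rewrite -expr2 sqr_ge0.
move=> /allP u0; apply/rowP => i; rewrite mxE.
by have := u0 i (mem_index_enum i); rewrite mulf_eq0 orbb => /eqP.
Qed.

Lemma norm2_ge0 u : 0 <= norm2 u.
Proof. exact: sqrtr_ge0. Qed.

Lemma norm2_sqr u : norm2 u ^+ 2 = dot u u.
Proof. exact/sqr_sqrtr/dotvv_ge0. Qed.

Lemma norm2_eq0 u : (norm2 u == 0) = (u == 0).
Proof. by rewrite -dotvv_eq0 -norm2_sqr sqrf_eq0. Qed.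

Lemma norm2_0 : norm2 (0 : V) = 0.
Proof. by apply/eqP; rewrite norm2_eq0. Qed.

Lemma norm2Z c u : norm2 (c *: u) = `|c| * norm2 u.
Proof. by rewrite /norm2 dotZl dotZr mulrA -expr2 sqrtrM ?sqr_ge0// sqrtr_sqr. Qed.

Lemma norm2N u : norm2 (- u) = norm2 u.
Proof. by rewrite -scaleN1r norm2Z normrN1 mul1r. Qed.

Lemma dot_le u v : dot u v <= norm2 u * norm2 v.
Proof.
have [u0|u_neq0] := eqVneq u 0; first by rewrite u0 dot0l norm2_0 mul0r.
have [v0|v_neq0] := eqVneq v 0; first by rewrite v0 dotC dot0l norm2_0 mulr0.
have u_gt0 : 0 < norm2 u by rewrite lt_neqAle norm2_ge0 eq_sym norm2_eq0 u_neq0.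
have v_gt0 : 0 < norm2 v by rewrite lt_neqAle norm2_ge0 eq_sym norm2_eq0 v_neq0.
have := dotvv_ge0 (norm2 v *: u - norm2 u *: v).
rewrite !dotE (dotC v u) -!norm2_sqr => sq_ge0.
rewrite -subr_ge0 -(pmulr_rge0 _ (mulr_gt0 u_gt0 v_gt0)).
by nra.
Qed.

Lemma norm2_le_of_dot u c :
  0 <= c -> (forall h, dot u h <= c * norm2 h) -> norm2 u <= c.
Proof.
move=> c_ge0 /(_ u); rewrite -norm2_sqr expr2.
have [->//|u_neq0] := eqVneq (norm2 u) 0.
by rewrite ler_pM2r// lt_neqAle norm2_ge0 eq_sym u_neq0.
Qed.

Lemma normr_coord_le u i : `|u 0 i| <= norm2 u.
Proof.
rewrite -(@ler_pXn2r _ 2)// ?nnegrE ?norm2_ge0// norm2_sqr real_normK ?num_real//.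
rewrite /dot (bigD1 i)//= -expr2 lerDl.
by apply: sumr_ge0 => j _; rewrite -expr2 sqr_ge0.
Qed.

(** Clarkson's inequality for exponents at least 2.  By the parallelogram law the
    squares of the two norms on the left sum to N^2, the mean of the squares of
    norm2 u and norm2 v; powers are superadditive, and N^(n+2) is at most the
    mean of the powers by the tangent inequality at N. *)
Lemma norm2_midpoint n u v :
  norm2 (2^-1 *: (u + v)) ^+ n.+2 + norm2 (2^-1 *: (u - v)) ^+ n.+2
  <= 2^-1 * (norm2 u ^+ n.+2 + norm2 v ^+ n.+2).
Proof.
set a := norm2 (_ *: _); set b := norm2 (2^-1 *: _).
pose N := Num.sqrt ((norm2 u ^+ 2 + norm2 v ^+ 2) / 2).
have N_ge0 : 0 <= N by exact: sqrtr_ge0.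
have N_sqr : N ^+ 2 = (norm2 u ^+ 2 + norm2 v ^+ 2) / 2.
  by rewrite sqr_sqrtr// divr_ge0// addr_ge0// sqr_ge0.
have a_ge0 : 0 <= a by exact: norm2_ge0.
have b_ge0 : 0 <= b by exact: norm2_ge0.
have abN : a ^+ 2 + b ^+ 2 = N ^+ 2.
  by rewrite N_sqr !norm2_sqr !dotE (dotC v u); field.
have le_pow c : 0 <= c -> c ^+ 2 <= N ^+ 2 -> c ^+ n.+2 <= c ^+ 2 * N ^+ n.
  move=> c_ge0; rewrite ler_pXn2r ?nnegrE// => cN.
  by rewrite -(addn2 n) exprD mulrC ler_wpM2l ?sqr_ge0// lerXn2r ?nnegrE.
have a_le : a ^+ n.+2 <= a ^+ 2 * N ^+ n by apply: le_pow => //; nra.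
have b_le : b ^+ n.+2 <= b ^+ 2 * N ^+ n by apply: le_pow => //; nra.
have Nu := tangent_power n (norm2_ge0 u) N_ge0.
have Nv := tangent_power n (norm2_ge0 v) N_ge0.
have NS : N ^+ n.+2 = (a ^+ 2 + b ^+ 2) * N ^+ n by rewrite abN -exprD.
have Nuv : N ^+ n * norm2 u ^+ 2 + N ^+ n * norm2 v ^+ 2 = 2 * N ^+ n.+2.
  by rewrite -(addn2 n) exprD N_sqr; field.
have nNuv : n.+2%:R * N ^+ n * norm2 u ^+ 2 + n.+2%:R * N ^+ n * norm2 v ^+ 2
    = 2 * (n%:R * N ^+ n.+2) + 4 * N ^+ n.+2.
  by rewrite -!mulrA -mulrDr Nuv -!natr1; ring.
by lra.
Qed.

End Euclidean.

(** * One-sided Taylor estimates and multilinear forms *)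

Section TaylorBound.
Variable R : realType.

Lemma invf_fact n : (n.+1`!%:R)^-1 * n.+1%:R = (n`!%:R)^-1 :> R.
Proof.
by rewrite factS natrM invfM mulrC mulrA mulfV ?mul1r// pnatr_eq0.
Qed.

(** Taylor's formula with a bound on one side only: if the n-th derivative exceeds
    its value at 0 by at most K t, integrating n times gives the estimate.  The
    function g i plays the i-th derivative, so that no iterated derivative of a
    function on the line has to be computed. *)
Lemma taylor_le n (g : nat -> R -> R) (K : R) :
  (forall (i : nat) (t : R), (i < n)%N -> is_derive t 1 (g i) (g i.+1 t)) ->
  (forall t : R, 0 <= t <= 1 -> g n t - g n 0 <= K * t) ->
  forall t : R, 0 <= t <= 1 ->
  g 0%N t <= \sum_(i < n.+1) (i`!%:R)^-1 * g i 0 * t ^+ i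
             + K / n.+1`!%:R * t ^+ n.+1.
Proof.
elim: n g => [|n IHn] g g_der g_lip t t01.
  rewrite big_ord1 factS fact0 muln1 !invr1 mul1r expr0 !mulr1 expr1.
  by rewrite -lerBlDl g_lip.
pose Q : {poly R} := \sum_(i < n.+2) ((i`!%:R)^-1 * g i 0) *: 'X^i
                     + (K / n.+2`!%:R) *: 'X^(n.+2).
have QE s : Q.[s] = \sum_(i < n.+2) (i`!%:R)^-1 * g i 0 * s ^+ i
             + K / n.+2`!%:R * s ^+ n.+2.
  rewrite hornerD horner_sum hornerZ hornerXn; congr (_ + _).
  by apply: eq_bigr => i _; rewrite hornerZ hornerXn.
have dQE s : Q^`().[s] = \sum_(i < n.+1) (i`!%:R)^-1 * g i.+1 0 * s ^+ i
             + K / n.+1`!%:R * s ^+ n.+1.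
  rewrite derivD hornerD derivZ derivXn hornerZ hornerMn hornerXn; congr (_ + _).
    rewrite linear_sum big_ord_recl /= derivZ derivXn mulr0n scaler0 add0r horner_sum.
    apply: eq_bigr => i _; rewrite derivZ derivXn hornerZ hornerMn hornerXn.
    by rewrite /bump leq0n add1n /= -(invf_fact i) -[s ^+ i *+ _]mulr_natr; ring.
  by rewrite -(invf_fact n.+1) -[s ^+ _ *+ _]mulr_natr [n.+2.-1]/=; ring.
have dg_le (s : R) : 0 <= s <= 1 -> g 1%N s <= Q^`().[s].
  move=> s01; rewrite dQE; apply: (IHn (fun i => g i.+1)) => // i r i_lt.
  exact: g_der.
have Q0 : Q.[0] = g 0%N 0.
  rewrite QE big_ord_recl/= fact0 invr1 mul1r expr0 mulr1 exprS mul0r mulr0 addr0.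
  by rewrite big1 ?addr0// => i _; rewrite exprS mul0r mulr0.
have w_der (s : R) : is_derive s 1 (g 0%N - horner Q) (g 1%N s - Q^`().[s]).
  by apply: is_deriveB; exact: g_der.
have /andP[t_ge0 t_le1] := t01.
have [|c] := MVT_segment t_ge0 (fun s _ => w_der s).
  by apply: derivable_within_continuous => s _; exact: ex_derive.
rewrite in_itv/= => /andP[c_ge0 c_le].
rewrite -QE !fctE Q0 subrr !subr0 => E; rewrite -subr_le0 E.
by rewrite mulr_le0_ge0// subr_le0 dg_le// c_ge0 (le_trans c_le).
Qed.

End TaylorBound.

Section Multilinear.
Variables (R : realType) (m : nat).
Local Notation V := 'rV[R]_m.
Implicit Types (u v x y h s : V) (hs : seq V) (F : seq V -> R).

(** Linearity in each argument on the lists of length n; nothing is required of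
    other lists, because nabla f hs is only controlled for hs of length at most p. *)
Definition multilinear n F := forall hs1 hs2 c u v,
  (size hs1 + size hs2).+1 = n ->
  F (hs1 ++ (c *: u + v) :: hs2) = c * F (hs1 ++ u :: hs2) + F (hs1 ++ v :: hs2).

Lemma multilinear_cons n F h :
  multilinear n.+1 F -> multilinear n (fun hs => F (h :: hs)).
Proof. by move=> FL hs1 hs2 c u v E; rewrite -!cat_cons FL//= -E. Qed.

Lemma multilinearB n F G : multilinear n F -> multilinear n G ->
  multilinear n (fun hs => F hs - G hs).
Proof. by move=> FL GL hs1 hs2 c u v E; rewrite FL// GL//; ring. Qed.

Section HeadArgument.
Variables (n : nat) (F : seq V -> R) (FL : multilinear n F).

Lemma multilinearD hs1 hs2 u v : (size hs1 + size hs2).+1 = n ->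
  F (hs1 ++ (u + v) :: hs2) = F (hs1 ++ u :: hs2) + F (hs1 ++ v :: hs2).
Proof. by move=> E; rewrite -[u]scale1r FL// mul1r scale1r. Qed.

Lemma multilinear0 hs1 hs2 : (size hs1 + size hs2).+1 = n ->
  F (hs1 ++ 0 :: hs2) = 0.
Proof.
move=> E; apply: (@addrI _ (F (hs1 ++ 0 :: hs2))).
by rewrite -multilinearD// !addr0.
Qed.

Lemma multilinearZ hs1 hs2 c u : (size hs1 + size hs2).+1 = n ->
  F (hs1 ++ c *: u :: hs2) = c * F (hs1 ++ u :: hs2).
Proof. by move=> E; rewrite -[c *: u]addr0 FL// multilinear0// addr0. Qed.

Lemma multilinear_nseqZ j hs1 hs2 c u : (size hs1 + (j + size hs2))%N = n ->
  F (hs1 ++ nseq j (c *: u) ++ hs2) = c ^+ j * F (hs1 ++ nseq j u ++ hs2).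
Proof.
elim: j hs1 => [|j IHj] hs1 E; first by rewrite expr0 mul1r.
rewrite /= multilinearZ; last by rewrite size_cat size_nseq -E addSn addnS.
by rewrite -!cat_rcons IHj ?size_rcons ?exprS ?mulrA// -E addSn addnS.
Qed.

End HeadArgument.

(** Expanding the head in the canonical basis reduces the length by one.  The bound
    makes the supremum in form_norm meaningful. *)
Lemma multilinear_bounded n F : multilinear n F ->
  exists B, forall hs, size hs = n -> (forall h, h \in hs -> norm2 h <= 1) ->
    `|F hs| <= B.
Proof.
elim: n F => [|n IHn] F FL.
  by exists `|F [::]| => hs /size0nil ->.
have /choice[B F_le] : forall i, exists B, forall hs, size hs = n ->
    (forall h, h \in hs -> norm2 h <= 1) -> `|F (delta_mx 0 i :: hs)| <= B.
  by move=> i; apply: (IHn (fun hs => F (_ :: hs))); exact: multilinear_cons.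
exists (\sum_i B i) => -[//|h hs] [hs_n] hs_le1.
have -> : F (h :: hs) = \sum_i h 0 i * F (delta_mx 0 i :: hs).
  rewrite {1}[h]row_sum_delta; elim/big_rec2: _ => [|i r v _ <-].
    by rewrite (multilinear0 FL (hs1 := [::]))//= hs_n.
  by rewrite (FL [::])//= hs_n.
apply: (le_trans (ler_norm_sum _ _ _)); apply: ler_sum => i _.
rewrite normrM -[leRHS]mul1r; apply: ler_pM => //.
  apply: le_trans (normr_coord_le _ _) _.
  by apply: hs_le1; rewrite mem_head.
by apply: F_le => // h' h'_in; apply: hs_le1; rewrite in_cons h'_in orbT.
Qed.

Lemma le_form_norm n F (hs : n.-tuple V) : multilinear n F ->
  (forall i, norm2 (tnth hs i) <= 1) ->
  F hs <= form_norm (fun t : n.-tuple V => F t).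
Proof.
move=> FL hs_le1; apply: ub_le_sup; last by exists hs.
have [B F_le] := multilinear_bounded FL.
exists B => _ [t t_le1 <-]; apply: le_trans (ler_norm _) (F_le _ _ _).
  by rewrite size_tuple.
by move=> h /tnthP[i ->].
Qed.

Lemma multilinear_le_form_norm n F s h : multilinear n.+1 F ->
  F (nseq n s ++ [:: h]) <=
  form_norm (fun t : n.+1.-tuple V => F t) * (norm2 s ^+ n * norm2 h).
Proof.
move=> FL.
have unitP u : u = norm2 u *: ((norm2 u)^-1 *: u) /\ norm2 ((norm2 u)^-1 *: u) <= 1.
  rewrite scalerA; have [u0|u_neq0] := eqVneq u 0.
    by rewrite u0 !scaler0 norm2_0.
  have nu_neq0 : norm2 u != 0 by rewrite norm2_eq0.
  by rewrite mulfV// scale1r norm2Z normfV ger0_norm ?norm2_ge0// mulVf.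
have [sE s_le1] := unitP s; have [hE h_le1] := unitP h.
set s1 := (norm2 s)^-1 *: s in sE s_le1; set h1 := (norm2 h)^-1 *: h in hE h_le1.
have -> : F (nseq n s ++ [:: h])
    = F (nseq n s1 ++ [:: h1]) * (norm2 s ^+ n * norm2 h).
  rewrite [in LHS]sE [in LHS]hE.
  rewrite (multilinear_nseqZ (hs1 := [::]) (hs2 := [:: _]) FL) ?addn1//=.
  by rewrite (multilinearZ (hs2 := [::]) FL) ?size_nseq ?addn0// mulrA mulrC.
apply: ler_wpM2r; first by rewrite mulr_ge0 ?exprn_ge0 ?norm2_ge0.
set hs := _ ++ _; have hs_size : size hs == n.+1.
  by rewrite size_cat size_nseq addn1.
apply: (le_form_norm (hs := Tuple hs_size) FL) => i.
have := mem_tnth i (Tuple hs_size).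
by rewrite mem_cat inE => /orP[/nseqP[-> _]|/eqP ->].
Qed.

(** Along a line the diagonal of a multilinear form is a polynomial, whose slope at
    0 collects the terms in which exactly one argument is h. *)
Lemma multilinear_diag_poly n F s h : multilinear n F ->
  exists P : {poly R}, (forall e, F (nseq n (s + e *: h)) = P.[e]) /\
    P^`().[0] = \sum_(j < n) F (nseq j s ++ h :: nseq (n - j.+1) s).
Proof.
elim: n F => [|n IHn] F FL.
  by exists (F [::])%:P; split => [e|]; rewrite ?hornerC// derivC horner0 big_ord0.
have [P [PE dPE]] := IHn _ (multilinear_cons s FL).
have [Q [QE _]] := IHn _ (multilinear_cons h FL).
exists (P + 'X * Q); split => [e|] /=.
  rewrite hornerD hornerM hornerX -PE -QE [s + _]addrC.
  by rewrite (FL [::]) ?size_nseq// [LHS]addrC.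
rewrite derivD derivM derivX mul1r !hornerD hornerM hornerX mul0r dPE -QE big_ord_recl.
by rewrite scale0r addr0 subn1 addrC addr0.
Qed.

End Multilinear.

(** * Symmetry of second derivatives *)

Section Symmetry.
Variables (R : realType) (V : normedModType R).
Implicit Types (g : V -> R) (x u v s : V).

Lemma is_derive_line g x s (t : R) : differentiable g (x + t *: s) ->
  is_derive t 1 (fun r : R => g (x + r *: s)) ('d g (x + t *: s) s).
Proof.
move=> g_diff.
have line_diff : is_diff t (fun r : R => x + r *: s) (fun r : R => r *: s).
  have := is_diffD (is_diff_cst x t) (is_diff_scalel t s).
  by rewrite add0r.
have comp_diff : differentiable (g \o (fun r : R => x + r *: s)) t.
  by apply: differentiable_comp => //; exact: ex_diff.
split; first exact/diff_derivable.
rewrite -[fun _ => _]/(g \o (fun r : R => x + r *: s)) deriveE//.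
by rewrite diff_comp//= diff_val/= scale1r.
Qed.

Lemma differential_at_lincomb g x u v (t r : R) :
  'd g x (t *: u + r *: v) = t * 'd g x u + r * 'd g x v.
Proof. by rewrite linearD !linearZ. Qed.

Lemma differentialZ g x u (t : R) : 'd g x (t *: u) = t * 'd g x u.
Proof. by rewrite linearZ. Qed.

Lemma differential_of_lincomb (F G : V -> R) x u (c : R) :
  differentiable F x -> differentiable G x ->
  'd (c *: F + G) x u = c * 'd F x u + 'd G x u.
Proof.
move=> F_diff G_diff; have cF_diff := differentiableZ c F_diff.
apply: etrans (f_equal (@^~ u) (diffD cF_diff G_diff)) _.
by congr (_ + _); exact: (f_equal (@^~ u) (diffZ c F_diff)).
Qed.

Lemma differential_approx g x : differentiable g x -> forall e : R, 0 < e ->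
  exists2 d : R, 0 < d &
  forall h, `|h| < d -> `|g (x + h) - g x - 'd g x h| <= e * `|h|.
Proof.
move=> /diff_locally g_diff e e_gt0.
have /eqaddoP/(_ e e_gt0) := g_diff.
rewrite near_simpl => /nbhs_ballP[d /= d_gt0 near_x].
exists d => // h h_lt; have := near_x h.
rewrite -ball_normE/= sub0r normrN => /(_ h_lt).
rewrite !fctE /= opprD addrA [h + x]addrC.
exact.
Qed.

(** The mixed increment is compared at two points at distance O(r) from x, so that
    both errors of the linear approximation at x are o(r). *)
Lemma differential_increment f x u v : differentiable f x ->
  forall e : R, 0 < e -> exists2 d : R, 0 < d & forall r t : R,
  0 < r < d -> 0 <= t <= r ->
  `|f (x + t *: u + r *: v) - f (x + t *: u) - r * 'd f x v| <= e * r.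
Proof.
move=> f_diff e e_gt0.
have nu := normr_ge0 u; have nv := normr_ge0 v.
(* Two errors, each relative to r (|u| + |v|), must add up to at most e r. *)
pose K := 2 * (`|u| + `|v|) + 1.
have K_gt0 : 0 < K by rewrite ltr_wpDl// mulr_ge0// addr_ge0.
have [d d_gt0 approx] := differential_approx f_diff (divr_gt0 e_gt0 K_gt0).
exists (d / K); first exact: divr_gt0.
move=> r t /andP[r_gt0 r_lt] /andP[t_ge0 t_le].
have rK_lt : r * K < d by rewrite -ltr_pdivlMr.
have tu_le : `|t *: u| <= r * `|u|.
  by rewrite normrZ ger0_norm// ler_wpM2r.
have rv_le : `|r *: v| = r * `|v| by rewrite normrZ gtr0_norm.
have h1_le : `|t *: u + r *: v| <= r * (`|u| + `|v|).
  by rewrite mulrDr (le_trans (ler_normD _ _))// rv_le lerD2r.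
have h2_le : `|t *: u| <= r * (`|u| + `|v|).
  by apply: le_trans tu_le _; rewrite ler_pM2l// lerDl.
have small : r * (`|u| + `|v|) < d by rewrite /K in rK_lt; nra.
have A1 := approx _ (le_lt_trans h1_le small).
have A2 := approx _ (le_lt_trans h2_le small).
have e_div : 0 <= e / K by rewrite divr_ge0 ?ltW.
have := le_trans A1 (ler_wpM2l e_div h1_le).
have := le_trans A2 (ler_wpM2l e_div h2_le).
rewrite differential_at_lincomb differentialZ addrA.
have EK : e / K * (r * (`|u| + `|v|)) * 2 <= e * r.
  rewrite [leLHS](_ : _ = e * r * (2 * (`|u| + `|v|) / K)); last first.
    by field; rewrite gt_eqF.
  rewrite -[leRHS]mulr1; apply: ler_wpM2l; first by rewrite mulr_ge0 ?ltW.
  by rewrite ler_pdivrMr// mul1r /K lerDl.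
by rewrite !ler_norml; lra.
Qed.

(** The second difference is the increment along u of the map sending z to
    g (z + r v) - g z; the mean value theorem turns it into r times an increment
    of the derivative in the direction u, which differential_increment evaluates. *)
Lemma second_difference g x u v :
  (forall z, differentiable g z) -> differentiable (fun z => 'd g z u) x ->
  forall e : R, 0 < e -> exists2 d : R, 0 < d & forall r : R, 0 < r < d ->
  `|(g (x + r *: u + r *: v) - g (x + r *: u) - g (x + r *: v) + g x) / r ^+ 2
    - 'd (fun z => 'd g z u) x v| <= e.
Proof.
move=> g_diff gu_diff e e_gt0.
have [d d_gt0 approx] := differential_increment u v gu_diff e_gt0.
exists d => // r r_in; have /andP[r_gt0 _] := r_in.
pose w := (fun t : R => g (x + r *: v + t *: u)) - (fun t : R => g (x + t *: u)).
have w_der (t : R) : is_derive t 1 w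
    ('d g (x + r *: v + t *: u) u - 'd g (x + t *: u) u).
  by apply: is_deriveB; exact: is_derive_line.
have [|t] := MVT_segment (ltW r_gt0) (fun t _ => w_der t).
  by apply: derivable_within_continuous => t _; exact: ex_derive.
rewrite in_itv/= subr0 /w !fctE !scale0r !addr0 => t_in.
rewrite ![x + r *: v + _]addrAC => E.
have -> : g (x + r *: u + r *: v) - g (x + r *: u) - g (x + r *: v) + g x
    = ('d g (x + t *: u + r *: v) u - 'd g (x + t *: u) u) * r.
  by rewrite -E; ring.
rewrite [X in `|X|](_ : _ = ('d g (x + t *: u + r *: v) u - 'd g (x + t *: u) u
    - r * 'd (fun z => 'd g z u) x v) / r); last by field; rewrite gt_eqF.
rewrite normrM normfV (gtr0_norm r_gt0) ler_pdivrMr//.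
exact: approx.
Qed.

(** The second difference is symmetric in u and v and approximates both mixed
    derivatives. *)
Lemma second_derivative_sym g x u v :
  (forall z, differentiable g z) ->
  differentiable (fun z => 'd g z u) x -> differentiable (fun z => 'd g z v) x ->
  'd (fun z => 'd g z u) x v = 'd (fun z => 'd g z v) x u.
Proof.
move=> g_diff gu_diff gv_diff; apply/eqP; rewrite -subr_eq0 -normr_le0.
apply/ler_addgt0Pl => e e_gt0; rewrite addr0.
have e2_gt0 : 0 < e / 2 by rewrite divr_gt0.
have [d1 d1_gt0 B1] := second_difference v g_diff gu_diff e2_gt0.
have [d2 d2_gt0 B2] := second_difference u g_diff gv_diff e2_gt0.
pose r := Num.min d1 d2 / 2.
have m_gt0 : 0 < Num.min d1 d2 by rewrite lt_min d1_gt0.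
have r_gt0 : 0 < r by rewrite divr_gt0.
have r_lt : r < Num.min d1 d2 by rewrite /r; lra.
move: r_lt; rewrite lt_min => /andP[r_lt1 r_lt2].
have := B1 r; have := B2 r; rewrite r_gt0 r_lt1 r_lt2 => /(_ isT) A2 /(_ isT).
move: A2; rewrite [x + r *: v + _]addrAC.
rewrite !ler_norml; set G := g _; set Gu := g _; set Gv := g _.
rewrite [G - Gu - Gv]addrAC; lra.
Qed.

End Symmetry.

(** * Iterated derivatives and the tensor step *)

Section HigherDerivatives.
Variables (R : realType) (m p : nat) (f : 'rV[R]_m -> R).
Hypothesis f_diff : p_differentiable p f.
Local Notation V := 'rV[R]_m.
Implicit Types (u v x s h : V) (hs : seq V).

Lemma nabla_linear hs1 hs2 (c : R) u v : (size hs1 + size hs2 < p)%N ->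
  nabla f (hs1 ++ (c *: u + v) :: hs2)
  = c *: nabla f (hs1 ++ u :: hs2) + nabla f (hs1 ++ v :: hs2).
Proof.
elim: hs1 => [|h hs1 IHhs] sz.
  apply/funext => x; have := differential_at_lincomb (nabla f hs2) x u v c 1.
  by rewrite scale1r mul1r.
apply/funext => x; rewrite cat_cons [LHS]/= IHhs; last exact: ltnW.
have d1 : differentiable (nabla f (hs1 ++ u :: hs2)) x.
  by apply: f_diff; rewrite size_cat /= addnS.
have d2 : differentiable (nabla f (hs1 ++ v :: hs2)) x.
  by apply: f_diff; rewrite size_cat /= addnS.
exact: differential_of_lincomb.
Qed.

Lemma multilinear_nabla n x : (n <= p)%N ->
  multilinear n (fun hs => nabla f hs x).
Proof. by move=> n_le hs1 hs2 c u v sz; rewrite nabla_linear// sz. Qed.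

Lemma nabla_swap hs1 hs2 u v : ((size hs1 + size hs2).+2 <= p)%N ->
  nabla f (hs1 ++ u :: v :: hs2) = nabla f (hs1 ++ v :: u :: hs2).
Proof.
elim: hs1 => [|h hs1 IHhs] sz; last first.
  by rewrite /= IHhs//; apply: leq_trans sz.
apply/funext => x; apply: (@second_derivative_sym _ _ (nabla f hs2) x v u).
- by move=> z; apply: f_diff; apply: leq_trans sz; rewrite add0n.
- exact: (f_diff (hs := v :: hs2)).
- exact: (f_diff (hs := u :: hs2)).
Qed.

(** Adjacent arguments commute by the symmetry of second derivatives, hence h can
    be carried through a block of copies of s. *)
Lemma nabla_move j s h hs : ((j + size hs).+1 <= p)%N ->
  nabla f (h :: nseq j s ++ hs) = nabla f (nseq j s ++ h :: hs).
Proof.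
elim: j => [//|j IHj] sz.
rewrite (@nabla_swap [::] (nseq j s ++ hs) h s).
  by rewrite /= -IHj//; apply: leq_trans sz.
by rewrite size_cat size_nseq.
Qed.

End HigherDerivatives.

Lemma ge0_from_right (R : realType) (w : R -> R) : {for 0, continuous w} ->
  (forall e : R, 0 < e -> 0 <= w e) -> 0 <= w 0.
Proof.
move=> w_cont w_ge0.
have wr : w @ (0 : R)^'+ --> w 0 by exact: cvg_at_right_filter.
rewrite -(cvg_lim _ wr)//; apply: limr_ge; first exact: cvgP wr.
by near=> e; apply: w_ge0; near: e; exact: nbhs_right_gt.
Unshelve. all: by end_near. Qed.

Lemma dot_grad (R : realType) m (f : 'rV[R]_m -> R) x h :
  dot (grad f x) h = nabla f [:: h] x.
Proof.
rewrite /= [in RHS](row_sum_delta h) linear_sum; apply: eq_bigr => i _.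
by rewrite mxE differentialZ mulrC.
Qed.

Section TensorStep.
Variables (R : realType) (m n : nat) (f : 'rV[R]_m -> R) (Mp M : R).
Local Notation p := n.+1.
Local Notation V := 'rV[R]_m.
Hypothesis f_diff : p_differentiable p f.
Implicit Types (u v x s h : V).

(** The derivative in the direction h of the Taylor polynomial of f at x, taken at
    the point x + s. *)
Definition model_slope x s h : R :=
  \sum_(i < p) (i`!%:R)^-1 * nabla f (nseq i s ++ [:: h]) x.

Lemma model_slopeN x s h : model_slope x s (- h) = - model_slope x s h.
Proof.
rewrite -sumrN; apply: eq_bigr => i _.
rewrite -scaleN1r (multilinearZ (hs2 := [::]) (multilinear_nabla f_diff x (n := i.+1) _)).
- by rewrite mulN1r mulrN.
- exact: ltn_ord.
- by rewrite size_nseq addn0.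
Qed.

(** Taylor's formula for the derivative of f in the direction h, along the segment
    from x to x + s; its derivative of order n is a value of the p-th derivative
    of f, whose variation the Lipschitz assumption bounds. *)
Lemma gradient_taylor x s h : lipschitz_nabla p Mp f ->
  nabla f [:: h] (x + s)
  <= model_slope x s h + Mp / p`!%:R * (norm2 s ^+ p * norm2 h).
Proof.
move=> f_lip.
pose g i (t : R) := nabla f (nseq i s ++ [:: h]) (x + t *: s).
have sz i : size (nseq i s ++ [:: h]) = i.+1 by rewrite size_cat size_nseq addn1.
have g_der (i : nat) (t : R) : (i < n)%N -> is_derive t 1 (g i) (g i.+1 t).
  by move=> i_lt; apply: is_derive_line; apply: f_diff; rewrite sz.
pose K := Mp * (norm2 s ^+ p * norm2 h).
have g_lip (t : R) : 0 <= t <= 1 -> g n t - g n 0 <= K * t.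
  move=> /andP[t_ge0 _]; rewrite /g scale0r addr0.
  have FL : multilinear p (fun hs => nabla f hs (x + t *: s) - nabla f hs x).
    by apply: multilinearB; exact: (multilinear_nabla f_diff _ (leqnn _)).
  apply: le_trans (multilinear_le_form_norm s h FL) _.
  have := f_lip (x + t *: s) x.
  rewrite [x + _ - x]addrC addKr norm2Z ger0_norm//.
  have sh_ge0 : 0 <= norm2 s ^+ n * norm2 h.
    by rewrite mulr_ge0 ?exprn_ge0 ?norm2_ge0.
  move=> /(ler_wpM2r sh_ge0)/le_trans; apply.
  by rewrite /K exprS le_eqVlt; apply/orP; left; apply/eqP; ring.
have := taylor_le g_der g_lip (t := 1).
rewrite ler01 lexx => /(_ isT); rewrite /g scale1r expr1n mulr1.
rewrite /K [X in _ <= _ + X]mulrAC => /le_trans; apply; rewrite lerD2r le_eqVlt.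
apply/orP; left; apply/eqP/eq_bigr => i _.
by rewrite expr1n mulr1 scale0r addr0.
Qed.

Lemma model_diag_poly x s h : exists2 P : {poly R},
  (forall e, \sum_(i < p.+1) (i`!%:R)^-1 * nabla f (nseq i (s + e *: h)) x = P.[e])
  & P^`().[0] = model_slope x s h.
Proof.
have /choice[P PE] : forall i : 'I_p.+1, exists P : {poly R},
    (forall e, nabla f (nseq i (s + e *: h)) x = P.[e]) /\
    P^`().[0] = \sum_(j < i) nabla f (nseq j s ++ h :: nseq (i - j.+1) s) x.
  move=> i; apply: multilinear_diag_poly (multilinear_nabla f_diff x _).
  by rewrite -ltnS.
exists (\sum_(i < p.+1) (i`!%:R)^-1 *: P i) => [e|].
  by rewrite horner_sum; apply: eq_bigr => i _; rewrite hornerZ (PE i).1.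
rewrite linear_sum /= horner_sum big_ord_recl linearZ hornerZ (PE _).2 big_ord0.
rewrite mulr0 add0r; apply: eq_bigr => i _.
rewrite linearZ hornerZ (PE _).2 lift0.
rewrite (eq_bigr (fun=> nabla f (nseq i s ++ [:: h]) x)) => [|j _].
  by rewrite sumr_const card_ord -(invf_fact R i) -[X in _ * X]mulr_natl mulrA.
have j_le : (j <= i)%N by rewrite -ltnS.
rewrite subSS -(@nabla_move _ _ _ _ f_diff j s h (nseq _ s)); last first.
  by rewrite size_nseq subnKC.
rewrite -(@nabla_move _ _ _ _ f_diff i s h [::]); last by rewrite addn0.
by rewrite cats0 -nseqD (subnKC j_le).
Qed.

(** Convexity of the power of the norm, with the subgradient at the displaced point:
    this avoids differentiating the norm, also at s = 0. *)
Lemma norm2_line_pow_le s h (e : R) :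
  norm2 (s + e *: h) ^+ n.+2 - norm2 s ^+ n.+2
  <= n.+2%:R / 2 * norm2 (s + e *: h) ^+ n * (e * (2 * dot s h + e * dot h h)).
Proof.
have := tangent_power n (norm2_ge0 s) (norm2_ge0 (s + e *: h)).
set N := norm2 (s + _).
have -> : norm2 s ^+ 2 = N ^+ 2 - e * (2 * dot s h + e * dot h h).
  by rewrite !norm2_sqr !dotE (dotC h s); ring.
have -> : n.+2%:R * N ^+ n * (N ^+ 2 - e * (2 * dot s h + e * dot h h))
  = 2 * N ^+ n.+2 + n%:R * N ^+ n.+2
    - 2 * (n.+2%:R / 2 * N ^+ n * (e * (2 * dot s h + e * dot h h))).
  by rewrite -!natr1 !exprS; field.
lra.
Qed.

Lemma norm2_line_continuous s h : continuous (fun e : R => norm2 (s + e *: h)).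
Proof.
pose W : {poly R} := (dot s s)%:P + (2 * dot s h) *: 'X + (dot h h) *: 'X^2.
have -> : (fun e : R => norm2 (s + e *: h)) = Num.sqrt \o horner W.
  apply/funext => e /=; congr Num.sqrt.
  rewrite !hornerD hornerC !hornerZ hornerX hornerXn !dotE (dotC h s); ring.
move=> e; apply: continuous_comp; first exact: continuous_horner.
exact: sqrt_continuous.
Qed.

(** First-order optimality of T for the regularized model.  The increment of the
    model from T to T + e h is nonnegative; bounded above by norm2_line_pow_le and
    divided by e > 0, it becomes a continuous function of e whose value at 0 is the
    stated derivative. *)
Lemma tensor_optimality x T h : 0 <= M ->
  is_argmin (tensor_model p M f x) T ->
  0 <= model_slope x (T - x) h + M / p`!%:R * norm2 (T - x) ^+ n * dot (T - x) h.
Proof.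
move=> M_ge0 T_min; set s := T - x.
have [P PE dP] := model_diag_poly x s h.
(* Q is the difference quotient of P at 0. *)
have /factor_theorem[Q PQ] : root (P - P.[0]%:P) 0.
  by rewrite /root hornerD hornerN hornerC subrr.
rewrite subr0 in PQ.
have PQE e : P.[e] - P.[0] = Q.[e] * e.
  by have := f_equal (horner^~ e) PQ; rewrite hornerD hornerN hornerC hornerM hornerX.
have <- : Q.[0] = model_slope x s h.
  rewrite -dP; have -> : P = Q * 'X + P.[0]%:P by rewrite -PQ subrK.
  by rewrite derivD derivC derivM derivX !hornerE.
pose w := horner Q + (fun e => M / p`!%:R * (norm2 (s + e *: h)) ^+ n)
          * horner ((dot s h)%:P + (2^-1 * dot h h) *: 'X).
have wE e : w e = Q.[e] + M / p`!%:R * (norm2 (s + e *: h)) ^+ n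
          * (dot s h + 2^-1 * dot h h * e).
  by rewrite /w !fctE !hornerE.
have <- : w 0 = Q.[0] + M / p`!%:R * norm2 s ^+ n * dot s h.
  by rewrite wE scale0r addr0 mulr0 addr0.
apply: ge0_from_right.
  apply: continuousD; first exact: continuous_horner.
  apply: continuousM; last exact: continuous_horner.
  apply: continuousM; first exact: cst_continuous.
  apply: (@continuous_comp _ _ _ (fun e : R => norm2 (s + e *: h)) (fun r => r ^+ n)).
    exact: norm2_line_continuous.
  exact: exprn_continuous.
move=> e e_gt0; rewrite -(pmulr_rge0 _ e_gt0).
have := T_min (T + e *: h); rewrite /tensor_model.
have -> : T + e *: h - x = s + e *: h by rewrite addrAC.
rewrite -/s PE.
have <- : P.[0] = \sum_(i < p.+1) (i`!%:R)^-1 * nabla f (nseq i s) x.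
  by rewrite -PE scale0r addr0.
have Mf_ge0 : 0 <= M / p.+1`!%:R by rewrite divr_ge0.
have := ler_wpM2l Mf_ge0 (norm2_line_pow_le s h e).
rewrite mulrBr => B1 B2.
have : 0 <= P.[e] - P.[0] + M / p.+1`!%:R * (n.+2%:R / 2 * norm2 (s + e *: h) ^+ n
    * (e * (2 * dot s h + e * dot h h))).
  by lra.
rewrite PQE wE => /le_trans; apply; rewrite le_eqVlt; apply/orP; left; apply/eqP.
by rewrite -(invf_fact _ p); field.
Qed.

(** The optimality condition in the direction - h cancels the slope of the Taylor
    polynomial against that of gradient_taylor, uniformly in h. *)
Lemma tensor_step_residual x T : lipschitz_nabla p Mp f -> 0 <= Mp -> 0 <= M ->
  is_argmin (tensor_model p M f x) T ->
  norm2 (grad f T + (M / p`!%:R * norm2 (T - x) ^+ n) *: (T - x))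
  <= Mp / p`!%:R * norm2 (T - x) ^+ p.
Proof.
move=> f_lip Mp_ge0 M_ge0 T_min; apply: norm2_le_of_dot => [|h].
  by rewrite mulr_ge0 ?divr_ge0 ?exprn_ge0 ?norm2_ge0.
have := gradient_taylor x (T - x) h f_lip.
have -> : x + (T - x) = T by rewrite addrC subrK.
have := tensor_optimality (- h) M_ge0 T_min; set s := T - x.
rewrite model_slopeN dotNr => opt taylor.
rewrite [dot _ h]dotDl [dot (_ *: s) h]dotZl dot_grad.
by lra.
Qed.

End TensorStep.

(** * The balance of one iteration *)

Lemma power_increment_le (R : realFieldType) n (x y : R) : 0 <= y -> y <= x ->
  x ^+ n.+1 - y ^+ n.+1 <= n.+1%:R * x ^+ n * (x - y).
Proof.
move=> y_ge0 yx; have x_ge0 := le_trans y_ge0 yx.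
elim: n => [|n IHn]; first by rewrite expr0 mulr1 !expr1 mul1r.
have -> : x ^+ n.+2 - y ^+ n.+2
    = x * (x ^+ n.+1 - y ^+ n.+1) + y ^+ n.+1 * (x - y).
  by rewrite !exprS; ring.
have -> : n.+2%:R * x ^+ n.+1 * (x - y)
    = x * (n.+1%:R * x ^+ n * (x - y)) + x ^+ n.+1 * (x - y).
  by rewrite -!natr1 !exprS; ring.
apply: lerD; first exact: ler_wpM2l.
by apply: ler_wpM2r; [rewrite subr_ge0|rewrite lerXn2r ?nnegrE].
Qed.

Section ResidualConsequences.
Variables (R : realType) (m n : nat).
Local Notation V := 'rV[R]_m.

(** Used with c = M / p! and d = Mp / p!: expanding the square of the norm isolates the
    inner product of g with - s. *)
Lemma residual_descent (g s : V) (c d : R) :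
  norm2 (g + (c * norm2 s ^+ n) *: s) <= d * norm2 s ^+ n.+1 ->
  norm2 g ^+ 2 + (c ^+ 2 - d ^+ 2) * norm2 s ^+ (n.+1 * 2)
  <= 2 * c * norm2 s ^+ n * dot g (- s).
Proof.
set r := norm2 s => res.
have r_sqr : r ^+ 2 = dot s s by exact: norm2_sqr.
have := ler_pM (norm2_ge0 _) (norm2_ge0 _) res res.
rewrite -!expr2 [norm2 (g + _) ^+ 2]norm2_sqr !dotE (dotC s g) -r_sqr -norm2_sqr.
rewrite exprM [r ^+ n.+1]exprS; set X := r ^+ n; set gs := dot g s; set ng := norm2 g.
rewrite -subr_ge0 => res2; rewrite -subr_ge0; congr (_ <= _) : res2.
by ring.
Qed.

(** The trade-off of one iteration.  Here c stands for M / p!, D for the difference of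
    the squares of M / p! and Mp / p!, A and a stand for A_(k+1) and a_k, W for the
    progress of the tensor step, r for its length, G for the norm of the gradient,
    t for the distance to the minimizer v_k and gam for the growth constant of
    psi_k.  The parameter tau is the ratio t / r in the worst case. *)
Lemma step_balance (A a gam c D tau W r G t : R) :
  (0 < n)%N -> 0 < A -> 0 < c -> 0 < tau ->
  0 <= D -> 0 <= r -> 0 <= t ->
  A * D <= n%:R * c * gam * tau ^+ n.+2 ->
  n%:R * (c * a * tau) ^+ 2 <= n.+2%:R * A ^+ 2 * D ->
  0 < r ->
  G ^+ 2 + D * r ^+ (n.+1 * 2) <= 2 * c * r ^+ n * W ->
  a * G * t <= A * W + gam * t ^+ n.+2.
Proof.
move=> n_gt0 A_gt0 c_gt0 tau_gt0 D_ge0 r_ge0 t_ge0 H1 H2 r_gt0 HW.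
have [z z_ge0 tE] : exists2 z, 0 <= z & t = tau * z.
  by exists (t / tau); [exact: divr_ge0 (ltW tau_gt0)|rewrite mulrC divfK ?gt_eqF].
have nR_gt0 : (0 : R) < n%:R by rewrite ltr0n.
have rn_gt0 : 0 < r ^+ n by rewrite exprn_gt0.
have A_ge0 := ltW A_gt0; have rn_ge0 := ltW rn_gt0.
have tangent := tangent_power n z_ge0 r_ge0.
rewrite -subr_ge0 -(pmulr_rge0 _ (_ : 0 < 2 * c * r ^+ n * A * n%:R)); last first.
  by rewrite !mulr_gt0.
have zS_ge0 : 0 <= z ^+ n.+2 by rewrite exprn_ge0.
have K1 : 0 <= n%:R * A ^+ 2 * (2 * c * r ^+ n * W - G ^+ 2 - D * r ^+ (n.+1 * 2)).
  apply: mulr_ge0; first by rewrite mulr_ge0 ?sqr_ge0// ltW.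
  by move: HW; lra.
have K2 : 0 <= n%:R * (A * G - c * r ^+ n * a * t) ^+ 2.
  by apply: mulr_ge0; last exact: sqr_ge0.
have K3 : 0 <= A * r ^+ n * z ^+ n.+2 * 2
                * (n%:R * c * gam * tau ^+ n.+2 - A * D).
  apply: mulr_ge0; last by rewrite subr_ge0.
  by apply: mulr_ge0 => //; exact: mulr_ge0 (mulr_ge0 A_ge0 rn_ge0) zS_ge0.
have K4 : 0 <= (r ^+ n * z) ^+ 2 * (n.+2%:R * A ^+ 2 * D - n%:R * (c * a * tau) ^+ 2).
  by apply: mulr_ge0; [exact: sqr_ge0|rewrite subr_ge0].
have K5 : 0 <= A ^+ 2 * D * r ^+ n
    * (2 * z ^+ n.+2 + n%:R * r ^+ n.+2 - n.+2%:R * r ^+ n * z ^+ 2).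
  apply: mulr_ge0; last by rewrite subr_ge0.
  by rewrite !mulr_ge0 ?sqr_ge0.
(* K1 uses the progress W, K2 completes the square in G, K3 and K4 insert the
   conditions on gam and a, and K5 is the tangent inequality for r and z. *)
rewrite [leRHS](_ : _ =
    n%:R * A ^+ 2 * (2 * c * r ^+ n * W - G ^+ 2 - D * r ^+ (n.+1 * 2))
  + n%:R * (A * G - c * r ^+ n * a * t) ^+ 2
  + A * r ^+ n * z ^+ n.+2 * 2 * (n%:R * c * gam * tau ^+ n.+2 - A * D)
  + (r ^+ n * z) ^+ 2 * (n.+2%:R * A ^+ 2 * D - n%:R * (c * a * tau) ^+ 2)
  + A ^+ 2 * D * r ^+ n
    * (2 * z ^+ n.+2 + n%:R * r ^+ n.+2 - n.+2%:R * r ^+ n * z ^+ 2)).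
  exact: addr_ge0 (addr_ge0 (addr_ge0 (addr_ge0 K1 K2) K3) K4) K5.
rewrite tE exprM exprMn !exprS; ring.
Qed.

End ResidualConsequences.

(** * The coefficients of the method *)

Ltac nonneg :=
  by do !(rewrite invr_ge0 || apply: exprn_ge0 || apply: mulr_ge0) => //;
  exact: ltW.

Section Coefficients.
Variables (R : realType) (n : nat) (M Mp : R).
Hypotheses (n_gt0 : (0 < n)%N) (Mp_ge0 : 0 <= Mp) (M_gt : Mp < M).
Local Notation p := n.+1.
Local Notation D := (M ^+ 2 - Mp ^+ 2).

(** The square of theta is the base of the real power in seq_A, so that A_k is
    theta^p times a power of k / (p+1). *)
Definition theta : R := Num.sqrt (n%:R * D / (4 * n.+2%:R * M ^+ 2)).

Let M_gt0 : 0 < M. Proof. exact: le_lt_trans M_gt. Qed.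
Let nR_gt0 : (0 : R) < n%:R. Proof. by rewrite ltr0n. Qed.
Let n2R_gt0 : (0 : R) < n.+2%:R. Proof. by rewrite ltr0n. Qed.

Lemma gap_gt0 : 0 < D.
Proof. by rewrite subr_gt0 ltrXn2r ?nnegrE // ltW. Qed.

Lemma theta_gt0 : 0 < theta.
Proof.
by rewrite sqrtr_gt0 divr_gt0 ?mulr_gt0 ?gap_gt0 ?exprn_gt0.
Qed.

Let th_gt0 : 0 < theta := theta_gt0.

Lemma gapE : D = 4 * M ^+ 2 * theta ^+ 2 * n.+2%:R / n%:R.
Proof.
rewrite sqr_sqrtr; last by rewrite divr_ge0 ?mulr_ge0 ?ltW ?gap_gt0 ?exprn_gt0.
by field; rewrite !gt_eqF.
Qed.

Lemma const_CE : const_C p M Mp = p%:R * M * theta * n.+2%:R / n%:R.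
Proof.
rewrite /const_C gapE.
have -> : (p%:R + 1) / (p%:R - 1) * (4 * M ^+ 2 * theta ^+ 2 * n.+2%:R / n%:R)
   = (2 * M * theta * n.+2%:R / n%:R) ^+ 2.
  rewrite natr1 -[X in _ / (X - 1)]natr1 addrK.
  by field; rewrite gt_eqF.
rewrite sqrtr_sqr ger0_norm; first by field; rewrite gt_eqF.
by rewrite divr_ge0 ?mulr_ge0 ?ltW ?theta_gt0.
Qed.

Lemma seq_AE k : seq_A p M Mp k = theta ^+ p * (k%:R / n.+2%:R) ^+ n.+2.
Proof.
rewrite /seq_A natr1 -[X in (X - 1)]natr1 addrK; congr (_ * _).
have q_ge0 : 0 <= n%:R * D / (4 * n.+2%:R * M ^+ 2).
  by rewrite divr_ge0 ?mulr_ge0 ?ltW ?gap_gt0 ?exprn_gt0.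
by rewrite [p%:R / 2]mulrC powRrM powR12_sqrt// powR_mulrn ?sqrtr_ge0.
Qed.

Lemma seq_A0 : seq_A p M Mp 0 = 0.
Proof. by rewrite seq_AE mulr0n mul0r expr0n mulr0. Qed.

Lemma seq_A_gt0 k : 0 < seq_A p M Mp k.+1.
Proof. by rewrite seq_AE mulr_gt0 ?exprn_gt0 ?theta_gt0 ?divr_gt0 ?ltr0n. Qed.

Lemma seq_A_ge0 k : 0 <= seq_A p M Mp k.
Proof. by case: k => [|k]; [rewrite seq_A0|exact/ltW/seq_A_gt0]. Qed.

Lemma seq_a_ge0 k : 0 <= seq_a p M Mp k.
Proof.
rewrite subr_ge0 !seq_AE; apply: ler_wpM2l; first exact/exprn_ge0/ltW/theta_gt0.
apply: lerXn2r; rewrite ?nnegrE ?divr_ge0//.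
by rewrite ler_pM2r ?invr_gt0// ler_nat.
Qed.

(** Convexity of t |-> t^(p+1): the increment from k to k+1 is at most (p+1) (k+1)^p. *)
Lemma seq_a_le k : seq_a p M Mp k * k.+1%:R <= seq_A p M Mp k.+1 * n.+2%:R.
Proof.
rewrite /seq_a !seq_AE -mulrBr !exprMn -mulrBl.
have := @power_increment_le R p k.+1%:R k%:R (ler0n _ _).
rewrite ler_nat leqnSn => /(_ isT).
have -> : k.+1%:R - k%:R = 1 :> R by rewrite -natr1 addrAC subrr add0r.
rewrite mulr1 => inc.
have K_ge0 : 0 <= theta ^+ p * n.+2%:R^-1 ^+ n.+2 * k.+1%:R.
  nonneg.
have := ler_wpM2l K_ge0 inc.
rewrite [k.+1%:R ^+ n.+2]exprS -subr_ge0 => h; rewrite -subr_ge0.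
by congr (_ <= _) : h; ring.
Qed.

(** The modulus of uniform convexity of psi_k: the factor of the norm power in
    psi_0, times the 2^(-p) that the midpoint inequality leaves. *)
Definition growth : R := const_C p M Mp / p.+1`!%:R / 2 ^+ p.

(** The ratio tau of step_balance for which increment_small holds with the bound of
    seq_a_le; growth_large then holds with room to spare. *)
Definition step_scale k : R := 2 * theta * k.+1%:R / n%:R.

Lemma step_scale_gt0 k : 0 < step_scale k.
Proof. by rewrite divr_gt0 ?mulr_gt0 ?theta_gt0. Qed.

Let fact_neq0 : (p`!%:R : R) != 0.
Proof. by rewrite pnatr_eq0 -lt0n fact_gt0. Qed.

Lemma growth_large k :
  seq_A p M Mp k.+1 * ((M / p`!%:R) ^+ 2 - (Mp / p`!%:R) ^+ 2)
  <= n%:R * (M / p`!%:R) * growth * step_scale k ^+ n.+2.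
Proof.
have -> : (M / p`!%:R) ^+ 2 - (Mp / p`!%:R) ^+ 2 = D / p`!%:R ^+ 2 by field.
rewrite gapE seq_AE /growth const_CE /step_scale (factS p) natrM.
set F := p`!%:R; set t := theta; set K := k.+1%:R.
(* Z is the common factor by which the inequality reduces to
   2 (p-1)^p <= p (p+1)^p, where n = p - 1. *)
pose Z := M ^+ 2 * t ^+ n.+3 * K ^+ n.+2 / F ^+ 2 * 2 / n%:R / (n%:R * n.+2%:R) ^+ p.
have Z_ge0 : 0 <= Z.
  rewrite /Z /F /K /t.
  nonneg.
have pow_le : 2 * (n%:R : R) ^+ p <= p%:R * n.+2%:R ^+ p.
  apply: ler_pM; rewrite ?exprn_ge0 ?ler_nat//.
  by rewrite lerXn2r ?nnegrE// ler_nat ltnW.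
have := ler_wpM2l Z_ge0 pow_le; rewrite -subr_ge0 => h; rewrite -subr_ge0.
congr (_ <= _) : h; rewrite /Z !exprMn !exprVn.
rewrite [n.+2%:R ^+ n.+2]exprS [n%:R ^+ n.+2]exprS [2 ^+ n.+2]exprS
  [t ^+ n.+3]exprS [t ^+ n.+2]exprS.
field.
by rewrite !expf_neq0 ?gt_eqF.
Qed.

Lemma increment_small k :
  n%:R * (M / p`!%:R * seq_a p M Mp k * step_scale k) ^+ 2
  <= n.+2%:R * seq_A p M Mp k.+1 ^+ 2
     * ((M / p`!%:R) ^+ 2 - (Mp / p`!%:R) ^+ 2).
Proof.
have -> : (M / p`!%:R) ^+ 2 - (Mp / p`!%:R) ^+ 2 = D / p`!%:R ^+ 2 by field.
rewrite gapE /step_scale; set F := p`!%:R; set t := theta.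
have := seq_a_le k; set a := seq_a _ _ _ _; set A := seq_A _ _ _ _ => aA.
have aK_ge0 : 0 <= a * k.+1%:R by rewrite mulr_ge0 ?seq_a_ge0.
have sq := ler_pM aK_ge0 aK_ge0 aA aA.
pose Z := 4 * M ^+ 2 * t ^+ 2 / F ^+ 2 / n%:R.
have Z_ge0 : 0 <= Z.
  rewrite /Z /F /t.
  nonneg.
have := ler_wpM2l Z_ge0 sq; rewrite -subr_ge0 => h; rewrite -subr_ge0.
congr (_ <= _) : h; rewrite /Z; field.
by rewrite fact_neq0 gt_eqF.
Qed.

End Coefficients.

(** * The estimating sequence *)

Section EstimatingSequence.
Variables (R : realType) (m n : nat) (M Mp : R) (phi : 'rV[R]_m -> R).
Variables (k : nat) (l v y : nat -> 'rV[R]_m).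
Hypotheses (n_gt0 : (0 < n)%N) (Mp_ge0 : 0 <= Mp) (M_gt : Mp < M).
Local Notation p := n.+1.
Local Notation psi := (psi p M Mp phi l).
Local Notation A := (seq_A p M Mp).
Local Notation a := (seq_a p M Mp).
Hypothesis phi_diff : p_differentiable p phi.
Hypothesis phi_lipschitz : lipschitz_nabla p Mp phi.
Hypothesis phi_above_tangent :
  forall x z, phi x + dot (grad phi x) (z - x) <= phi z.
Hypothesis run : method_run p M Mp phi k l v y.

Let M_gt0 : 0 < M. Proof. exact: le_lt_trans M_gt. Qed.

Lemma const_C_ge0 : 0 <= const_C p M Mp.
Proof. by rewrite mulr_ge0 ?sqrtr_ge0 ?divr_ge0. Qed.

Lemma growth_ge0 : 0 <= growth n M Mp.
Proof. by rewrite !divr_ge0 ?const_C_ge0 ?exprn_ge0. Qed.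

(** The affine terms of psi contribute nothing, so the inequality is the one for the
    norm power. *)
Lemma psi_midpoint i u z :
  psi i (2^-1 *: (u + z)) + 2^-1 * growth n M Mp * norm2 (u - z) ^+ p.+1
  <= 2^-1 * (psi i u + psi i z).
Proof.
elim: i => [|i IHi] /=.
  rewrite (run_l0 run) !subr0.
  have C_ge0 : 0 <= const_C p M Mp / p.+1`!%:R by rewrite divr_ge0 ?const_C_ge0.
  have := ler_wpM2l C_ge0 (norm2_midpoint n u z).
  rewrite [norm2 (_ *: (u - z))]norm2Z ger0_norm// exprMn exprVn /growth.
  have -> : (2 ^+ n.+2 : R)^-1 = 2^-1 / 2 ^+ p by rewrite exprS invfM.
  by lra.
set c := a i; set g := grad phi _; set b := phi _.
have -> : dot g (2^-1 *: (u + z) - l i.+1)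
    = 2^-1 * (dot g (u - l i.+1) + dot g (z - l i.+1)).
  by rewrite !dotE; field.
by lra.
Qed.

(** Compare the minimum v_i with the midpoint of z and v_i. *)
Lemma psi_growth i z : (i < k)%N ->
  psi i (v i) + growth n M Mp * norm2 (z - v i) ^+ p.+1 <= psi i z.
Proof.
move=> i_lt; have := psi_midpoint i z (v i).
have := run_v run i_lt (2^-1 *: (z + v i)); lra.
Qed.

(** The decrease that the new linear term can cause at z is paid for by the progress
    of the tensor step and by the growth of psi_i between v_i and z. *)
Lemma step_gain i z : (i < k)%N ->
  a i * dot (grad phi (l i.+1)) (v i - z)
  <= A i.+1 * dot (grad phi (l i.+1)) (y i - l i.+1)
     + growth n M Mp * norm2 (z - v i) ^+ p.+1.
Proof.
move=> i_lt; set g := grad phi _.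
have res := tensor_step_residual phi_diff phi_lipschitz Mp_ge0 (ltW M_gt0)
  (run_l run i_lt).
rewrite -/g in res; set s := l i.+1 - y i in res.
have -> : y i - l i.+1 = - s by rewrite opprB.
have gain_ge0 : 0 <= growth n M Mp * norm2 (z - v i) ^+ p.+1.
  by rewrite mulr_ge0 ?growth_ge0 ?exprn_ge0 ?norm2_ge0.
(* A step of length zero forces the gradient to vanish. *)
have [s0|s_neq0] := eqVneq s 0.
  have g0 : g = 0.
    apply/eqP; rewrite -norm2_eq0 -normr_le0 ger0_norm ?norm2_ge0//.
    by move: res; rewrite s0 scaler0 addr0 norm2_0 exprS mul0r mulr0.
  by rewrite g0 !dot0l !mulr0 add0r.
have r_gt0 : 0 < norm2 s by rewrite lt_neqAle norm2_ge0 eq_sym norm2_eq0 s_neq0.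
have F_gt0 : (0 : R) < p`!%:R by rewrite ltr0n fact_gt0.
have c_gt0 : 0 < M / p`!%:R by rewrite divr_gt0.
have gap_ge0 : 0 <= (M / p`!%:R) ^+ 2 - (Mp / p`!%:R) ^+ 2.
  rewrite subr_ge0; apply: lerXn2r; rewrite ?nnegrE ?divr_ge0 ?(ltW M_gt0)//.
  by rewrite ler_pM2r ?invr_gt0// ltW.
have := step_balance n_gt0 (seq_A_gt0 n_gt0 Mp_ge0 M_gt i) c_gt0
  (step_scale_gt0 n_gt0 Mp_ge0 M_gt i) gap_ge0 (norm2_ge0 s)
  (norm2_ge0 (z - v i)) (growth_large n_gt0 Mp_ge0 M_gt i)
  (increment_small n_gt0 Mp_ge0 M_gt i) r_gt0 (residual_descent res).
apply: le_trans; rewrite -mulrA; apply: ler_wpM2l; first exact: seq_a_ge0.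
by rewrite -(norm2N (z - v i)) opprB dot_le.
Qed.

(** In the inductive step phi (l i) is bounded below by the tangent at l i.+1, and
    the choice of y i makes the linear terms combine into
    A_(i+1) <g, y_i - l_(i+1)> + a_i <g, z - v_i>, which step_gain controls. *)
Lemma estimating_sequence i z : (i <= k)%N -> A i * phi (l i) <= psi i z.
Proof.
elim: i z => [|i IHi] z i_le.
  rewrite seq_A0// mul0r mulr_ge0 ?exprn_ge0 ?norm2_ge0//.
  by rewrite divr_ge0 ?const_C_ge0.
have tangent := ler_wpM2l (seq_A_ge0 n_gt0 Mp_ge0 M_gt i)
  (phi_above_tangent (l i.+1) (l i)).
have gain := step_gain z i_le; have grow := psi_growth z i_le.
have IH := IHi (v i) (ltnW i_le).
have A_neq0 : A i.+1 != 0 by rewrite gt_eqF ?seq_A_gt0.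
have aE : A i.+1 = A i + a i by rewrite addrC subrK.
have yE : A i.+1 *: y i = A i *: l i + a i *: v i.
  by rewrite (run_y run)// scalerDr !scalerA ![A i.+1 * _]mulrC !divfK.
rewrite [psi i.+1 z]/=; set g := grad phi _ in tangent gain *.
have E : A i.+1 * dot g (y i - l i.+1)
    = A i * dot g (l i - l i.+1) + a i * dot g (v i - l i.+1).
  rewrite -!dotZr -dotDr !scalerBr yE aE [(A i + a i) *: l i.+1]scalerDl; congr (dot _ _).
  by rewrite opprD addrACA.
move: gain; rewrite E aE !dotE; move: tangent; rewrite !dotE; lra.
Qed.

End EstimatingSequence.

(** * Duality and the final constant *)

(** A subgradient is bounded above by the derivative in every direction; in the
    directions h and - h this forces equality. *)
Lemma grad_eq_subgradient (R : realType) m (phi : 'rV[R]_m -> R) x w :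
  differentiable phi x -> (forall z, phi x + dot w (z - x) <= phi z) ->
  grad phi x = w.
Proof.
move=> phi_diff w_sub.
have w_le h : dot w h <= nabla phi [:: h] x.
  apply/ler_addgt0Pr => e e_gt0.
  have K_gt0 : 0 < `|h| + 1 by rewrite ltr_wpDl.
  have [d d_gt0 approx] := differential_approx phi_diff (divr_gt0 e_gt0 K_gt0).
  pose r := d / (`|h| + 1) / 2.
  have r_gt0 : 0 < r by rewrite !divr_gt0.
  have rh : `|r *: h| = r * `|h| by rewrite normrZ gtr0_norm.
  have rh_lt : `|r *: h| < d.
    have -> : d = r * 2 * (`|h| + 1) by rewrite /r; field; rewrite gt_eqF.
    by rewrite rh; have := normr_ge0 h; nra.
  have := approx _ rh_lt; rewrite rh differentialZ => /ler_normlW le_e.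
  have := w_sub (x + r *: h); rewrite [x + _ - x]addrC addKr dotZr => ge_w.
  rewrite -(ler_pM2l r_gt0) /=.
  have : e / (`|h| + 1) * (r * `|h|) <= r * e.
    have -> : e / (`|h| + 1) * (r * `|h|) = r * e * (`|h| / (`|h| + 1)).
      by field; rewrite gt_eqF.
    rewrite -[leRHS]mulr1; apply: ler_wpM2l; first by rewrite mulr_ge0 ?ltW.
    by rewrite ler_pdivrMr// mul1r lerDl.
  by move: le_e ge_w; lra.
apply/eqP; rewrite -subr_eq0 -dotvv_eq0 eq_le dotvv_ge0 andbT.
set h := grad phi x - w; have := w_le (- h).
rewrite -dot_grad !dotNr lerN2 => wh.
by rewrite {1}/h dotDl dotNl subr_le0.
Qed.

Section Jensen.
Variables (R : realType) (E : vectType R) (Q : set E) (f : E -> R).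
Hypotheses (Q_convex : convex_set Q) (f_convex : convex_function Q f).

Lemma convex_pair (s t : R) x y : 0 <= s -> 0 <= t -> s + t = 1 -> Q x -> Q y ->
  Q (s *: x + t *: y) /\ f (s *: x + t *: y) <= s * f x + t * f y.
Proof.
move=> s_ge0 t_ge0 st1 /mem_set Qx /mem_set Qy.
have s_le1 : s <= 1 by lra.
have tE : t = 1 - s by lra.
split.
  by have := Q_convex (Itv01 s_ge0 s_le1) Qx Qy; rewrite inE /conv/= tE.
by have := f_convex (Itv01 s_ge0 s_le1) Qx Qy; rewrite /conv/= tE.
Qed.

End Jensen.

Lemma sup_max (R : realType) (T : Type) (D : set T) (g : T -> R) x :
  D x -> (forall z, D z -> g z <= g x) -> sup [set g z | z in D] = g x.
Proof.
move=> Dx g_le; apply/eqP; rewrite eq_le; apply/andP; split.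
  by apply: ge_sup; [exists (g x), x|move=> _ [z Dz <-]; exact: g_le].
apply: ub_le_sup; last by exists x.
by exists (g x) => _ [z Dz <-]; exact: g_le.
Qed.

Section Dual.
Variables (R : realType) (E : vectType R) (m : nat).
Variables (Q : set E) (f : E -> R) (A : {linear E -> 'rV[R]_m}) (b : 'rV[R]_m).
Variable xsel : 'rV[R]_m -> E.
Hypothesis xselP : forall mu, is_argmax_on Q (lagrangian f A mu) (xsel mu).
Local Notation phi := (dual Q f A b).

Lemma dualE mu : phi mu = dot mu (b - A (xsel mu)) - f (xsel mu).
Proof.
have [Qx x_max] := xselP mu.
rewrite /dual (sup_max Qx x_max) /lagrangian /adjoint !dotE; ring.
Qed.

Lemma dual_ge mu x : Q x -> dot mu (b - A x) - f x <= phi mu.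
Proof.
move=> Qx; rewrite dualE; have [_ /(_ _ Qx)] := xselP mu.
rewrite /lagrangian /adjoint !dotE; lra.
Qed.

(** The affine minorant of the dual function defined by the maximizer at mu is exact
    at mu. *)
Lemma dual_above_tangent mu nu :
  phi mu + dot (b - A (xsel mu)) (nu - mu) <= phi nu.
Proof.
have [Qx _] := xselP mu.
have := dual_ge nu Qx; rewrite (dualE mu) (dotC (b - _) (nu - mu)) dotDl dotNl; lra.
Qed.

Lemma grad_dual mu : differentiable phi mu -> grad phi mu = b - A (xsel mu).
Proof.
move=> phi_diff; apply: grad_eq_subgradient => // nu.
exact: dual_above_tangent.
Qed.

End Dual.

Section Constant.
Variables (R : realType) (n : nat) (M Mp : R).
Hypotheses (n_gt0 : (0 < n)%N) (Mp_ge0 : 0 <= Mp) (M_gt : Mp < M).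
Local Notation p := n.+1.

Lemma const_C1E : const_C1 p M Mp
  = 2 ^+ n.+2 * M * n.+2%:R ^+ n.+3 / (n`!%:R * theta n M Mp ^+ n * n%:R).
Proof.
have M_gt0 : 0 < M by exact: le_lt_trans M_gt.
have th_gt0 := theta_gt0 n_gt0 Mp_ge0 M_gt.
have nR_gt0 : (0 : R) < n%:R by rewrite ltr0n.
have F_neq0 : (n`!%:R : R) != 0 by rewrite pnatr_eq0 -lt0n fact_gt0.
rewrite /const_C1 (gapE n_gt0 Mp_ge0 M_gt) natr1 -[X in (X - 1)]natr1 addrK.
rewrite [p.-1]/= (_ : (3 * p + 3 = n + n.+3 * 2)%N); last by ring.
set th := theta _ _ _; set N := n.+2%:R.
have -> : N ^+ (n + n.+3 * 2) / ((4 * M ^+ 2 * th ^+ 2 * N / n%:R) ^+ n * n%:R ^+ n.+2)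
    = (N ^+ n.+3 / (2 ^+ n * M ^+ n * th ^+ n * n%:R)) ^+ 2.
  have -> : 4 = 2 ^+ 2 :> R by rewrite -natrX.
  rewrite exprD exprM !exprMn exprVn -(addn2 n) exprD.
  field.
  by rewrite !expf_neq0 ?gt_eqF.
rewrite sqrtr_sqr ger0_norm; last first.
  rewrite /th.
  nonneg.
have -> : 4 = 2 * 2 :> R by rewrite -natrM.
rewrite exprMn [2 ^+ n.+2]exprS [M ^+ p]exprS [2 ^+ p]exprS.
by field; rewrite F_neq0 !expf_neq0 ?gt_eqF.
Qed.

(** The two sides agree up to a factor p+1, which the stated constant gives away. *)
Lemma rate_le k rad : (0 < k)%N -> 0 <= rad ->
  const_C p M Mp / p.+1`!%:R * (2 * rad) ^+ p.+1 / seq_A p M Mp k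
  <= const_C1 p M Mp * rad ^+ p.+1 / k%:R ^+ p.+1.
Proof.
move=> k_gt0 rad_ge0.
have M_gt0 : 0 < M by exact: le_lt_trans M_gt.
have th_gt0 := theta_gt0 n_gt0 Mp_ge0 M_gt.
have nR_gt0 : (0 : R) < n%:R by rewrite ltr0n.
have kR_gt0 : (0 : R) < k%:R by rewrite ltr0n.
have F_neq0 : (n`!%:R : R) != 0 by rewrite pnatr_eq0 -lt0n fact_gt0.
rewrite const_C1E const_CE// seq_AE// (factS p) natrM (factS n) natrM.
set F := n`!%:R; set th := theta _ _ _; set N := n.+2%:R; set K := k%:R.
pose Z := 2 ^+ n.+2 * M * N ^+ n.+2 / (F * th ^+ n * n%:R) * rad ^+ n.+2 / K ^+ n.+2.
have Z_ge0 : 0 <= Z.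
  rewrite /Z /F /N /K /th.
  nonneg.
have N_ge1 : 1 <= N by rewrite ler1n.
have := ler_wpM2l Z_ge0 N_ge1; rewrite -subr_ge0 => h; rewrite -subr_ge0.
congr (_ <= _) : h; rewrite /Z !exprMn exprVn [N ^+ n.+3]exprS [th ^+ p]exprS.
by field; rewrite F_neq0 !expf_neq0 ?gt_eqF.
Qed.

End Constant.

(** * Convergence of the primal-dual method *)

Lemma psiE (R : realType) (m p : nat) (M Mp : R) (phi : 'rV[R]_m -> R) l j z :
  psi p M Mp phi l j z
  = const_C p M Mp / p.+1`!%:R * norm2 (z - l 0%N) ^+ p.+1
    + \sum_(i < j) seq_a p M Mp i
        * (phi (l i.+1) + dot (grad phi (l i.+1)) (z - l i.+1)).
Proof.
elim: j => [|j IHj] /=; first by rewrite big_ord0 addr0.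
by rewrite IHj big_ord_recr addrA.
Qed.

Section PrimalAverage.
Variables (R : realType) (E : vectType R) (m n : nat) (M Mp : R).
Variables (Q : set E) (f : E -> R) (xsel : 'rV[R]_m -> E) (l : nat -> 'rV[R]_m).
Hypotheses (n_gt0 : (0 < n)%N) (Mp_ge0 : 0 <= Mp) (M_gt : Mp < M).
Hypotheses (Q_convex : convex_set Q) (f_convex : convex_function Q f).
Hypothesis xselQ : forall mu, Q (xsel mu).
Local Notation p := n.+1.
Local Notation S := (seq_A p M Mp).
Local Notation a := (seq_a p M Mp).
Local Notation xbar := (xhat p M Mp xsel l).

Lemma scale_xhat j : S j.+1 *: xbar j.+1 = \sum_(i < j.+1) a i *: xsel (l i.+1).
Proof. by rewrite scalerA divff ?scale1r// gt_eqF ?seq_A_gt0. Qed.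

(** The point xhat k.+1 is a convex combination of xhat k and the next primal point.
    The recursion starts at index 1, since the weight A_0 vanishes. *)
Lemma xhat_jensen j :
  Q (xbar j.+1) /\ S j.+1 * f (xbar j.+1) <= \sum_(i < j.+1) a i * f (xsel (l i.+1)).
Proof.
elim: j => [|j [Qx fx]].
  have S_neq0 : S 1 != 0 by rewrite gt_eqF ?seq_A_gt0.
  have a0 : a 0 = S 1 by rewrite /seq_a seq_A0 ?subr0.
  by rewrite /xhat !big_ord1 a0 scalerA mulVf// scale1r.
have S_gt0 : 0 < S j.+2 by exact: seq_A_gt0.
have S_neq0 : S j.+2 != 0 by rewrite gt_eqF.
have SE : S j.+2 = S j.+1 + a j.+1 by rewrite addrC subrK.
have xE : xbar j.+2 = (S j.+1 / S j.+2) *: xbar j.+1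
                      + (a j.+1 / S j.+2) *: xsel (l j.+2).
  rewrite {1}/xhat big_ord_recr /= scalerDr scalerA [_^-1 * a _]mulrC.
  by rewrite -scale_xhat scalerA [_^-1 * S _]mulrC.
have s_ge0 : 0 <= S j.+1 / S j.+2 by rewrite divr_ge0 ?seq_A_ge0.
have t_ge0 : 0 <= a j.+1 / S j.+2 by rewrite divr_ge0 ?seq_A_ge0 ?seq_a_ge0.
have st1 : S j.+1 / S j.+2 + a j.+1 / S j.+2 = 1 by rewrite -mulrDl -SE divff.
have := convex_pair Q_convex f_convex s_ge0 t_ge0 st1 Qx (xselQ (l j.+2)).
rewrite -xE => -[Qx2 fx2]; split=> //; rewrite big_ord_recr /=.
have := ler_wpM2l (ltW S_gt0) fx2.
have SV q r : S j.+2 * (q / S j.+2 * r) = q * r.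
  by rewrite mulrA [S _ * _]mulrC divfK.
rewrite mulrDr !SV => /le_trans; apply.
by rewrite lerD2r.
Qed.

Lemma sum_seq_a j : \sum_(i < j) a i = S j.
Proof.
elim: j => [|j IHj]; first by rewrite big_ord0 seq_A0.
by rewrite big_ord_recr /= IHj addrC subrK.
Qed.

Lemma residual_xhat (A : {linear E -> 'rV[R]_m}) b j :
  S j.+1 *: (b - A (xbar j.+1)) = \sum_(i < j.+1) a i *: (b - A (xsel (l i.+1))).
Proof.
under eq_bigr do rewrite scalerBr.
rewrite sumrB -scaler_suml sum_seq_a scalerBr -linearZ scale_xhat linear_sum.
by congr (_ - _); apply: eq_bigr => i _; rewrite /= linearZ.
Qed.

End PrimalAverage.

Theorem theorem5p4 (R : realType) (E : vectType R) (m p : nat)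
    (Q : set E) (f : E -> R) (A : {linear E -> 'rV[R]_m}) (b : 'rV[R]_m)
    (xsel : 'rV[R]_m -> E) (Mp M rad : R) (lstar : 'rV[R]_m)
    (k : nat) (l v y : nat -> 'rV[R]_m)
    (phi := dual Q f A b)
    (p_ge2 : (2 <= p)%N)
    (Q_closed : vclosed Q)
    (Q_convex : convex_set Q)
    (f_convex : convex_function Q f)
    (xselP : forall mu, is_argmax_on Q (lagrangian f A mu) (xsel mu))
    (phi_convex : convex_function [set: 'rV[R]_m] phi)
    (phi_diff : p_differentiable p phi)
    (Mp_ge0 : 0 <= Mp)
    (phi_lipschitz : lipschitz_nabla p Mp phi)
    (lstar_min : is_argmin phi lstar)
    (rad_gt0 : 0 < rad)
    (lstar_rad : norm2 lstar <= rad)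
    (M_gt : Mp < M)
    (k_ge1 : (1 <= k)%N)
    (run : method_run p M Mp phi k l v y) :
  norm2 (A (xhat p M Mp xsel l k) - b) <= const_C1 p M Mp * rad ^+ p / k%:R ^+ p.+1
  /\ `|phi (l k) + f (xhat p M Mp xsel l k)|
     <= const_C1 p M Mp * rad ^+ p.+1 / k%:R ^+ p.+1.
Proof.
case: p => [//|n] in p_ge2 phi_diff phi_lipschitz run *.
have n_gt0 : (0 < n)%N by [].
have grad_phi mu : grad phi mu = b - A (xsel mu).
  by apply: grad_dual => //; exact: (phi_diff [::]).
have tangent mu nu : phi mu + dot (grad phi mu) (nu - mu) <= phi nu.
  by rewrite grad_phi; exact: dual_above_tangent.
case: k => [//|j] in k_ge1 run *.
have xselQ mu : Q (xsel mu) by have [] := xselP mu.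
have [Qx f_jensen] := xhat_jensen l n_gt0 Mp_ge0 M_gt Q_convex f_convex xselQ j.
have residual := residual_xhat xsel l n_gt0 Mp_ge0 M_gt A b j.
set x := xhat _ _ _ _ _ _ in Qx f_jensen residual *.
set S := seq_A _ _ _ _ in f_jensen residual.
have S_gt0 : 0 < S by exact: seq_A_gt0.
set w := b - A x in residual; pose delta := phi (l j.+1) + f x.
pose c := const_C n.+1 M Mp / n.+2`!%:R.
have c_ge0 : 0 <= c by rewrite divr_ge0 ?const_C_ge0.
have weak z : delta <= dot z w + c * norm2 z ^+ n.+2 / S.
  rewrite -(ler_pM2l S_gt0) [leRHS]mulrDr [S * (_ / S)]mulrC divfK ?gt_eqF//.
  have := estimating_sequence n_gt0 Mp_ge0 M_gt phi_diff phi_lipschitz tangent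
    run z (leqnn _).
  rewrite psiE (run_l0 run) subr0 -/S -/c.
  rewrite (eq_bigr (fun i : 'I_j.+1 =>
      dot z (seq_a n.+1 M Mp i *: (b - A (xsel (l i.+1))))
      - seq_a n.+1 M Mp i * f (xsel (l i.+1)))) => [|i _]; last first.
    by rewrite grad_phi [phi _](dualE b xselP) (dotC (b - _)) !dotE; ring.
  rewrite sumrB -(big_morph _ (dotDr z) (dot0r z)) -residual dotZr.
  by rewrite /delta [S * (_ + f x)]mulrDr; lra.
pose eps := c * (2 * rad) ^+ n.+2 / S.
have w_ge0 := norm2_ge0 w.
have upper : delta <= eps - 2 * rad * norm2 w.
  (* The vector of length 2 rad opposite to w; it is 0 when w = 0. *)
  apply: le_trans (weak (- (2 * rad) *: ((norm2 w)^-1 *: w))) _.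
  have dir_dot : dot ((norm2 w)^-1 *: w) w = norm2 w.
    rewrite dotZl -norm2_sqr expr2 mulrA; have [->|w_neq0] := eqVneq (norm2 w) 0.
      by rewrite mulr0.
    by rewrite mulVf// mul1r.
  have dir_le1 : norm2 ((norm2 w)^-1 *: w) <= 1.
    rewrite norm2Z normfV ger0_norm//; have [->|w_neq0] := eqVneq (norm2 w) 0.
      by rewrite mulr0.
    by rewrite mulVf.
  rewrite dotZl dir_dot mulNr addrC lerD2r ler_pM2r ?invr_gt0//.
  have rad2_ge0 : 0 <= 2 * rad by rewrite mulr_ge0 ?ltW.
  apply: ler_wpM2l => //; apply: lerXn2r; rewrite ?nnegrE ?norm2_ge0//.
  by rewrite norm2Z normrN ger0_norm// -[leRHS]mulr1; exact: ler_wpM2l.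
have lower : - (rad * norm2 w) <= delta.
  have := dual_ge b xselP lstar Qx; have := lstar_min (l j.+1).
  have := dot_le (- lstar) w; rewrite norm2N dotNl -/w -/phi /delta.
  have := ler_wpM2r w_ge0 lstar_rad.
  by lra.
have rate := rate_le n_gt0 Mp_ge0 M_gt k_ge1 (ltW rad_gt0).
rewrite -/c -/S -/eps in rate.
have rw_ge0 : 0 <= rad * norm2 w by rewrite mulr_ge0 ?(ltW rad_gt0).
split; last by rewrite -/delta ler_norml; apply/andP; split; lra.
rewrite -opprB norm2N -(ler_pM2l rad_gt0).
rewrite [leRHS](_ : _ = const_C1 n.+1 M Mp * rad ^+ n.+2 / j.+1%:R ^+ n.+2).
  by lra.
by rewrite [rad ^+ n.+2]exprS; ring.
Qed.
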